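(* Let $a_1,\dots,a_n\in\mathbb{R}$. Then for any $\rho\in(0,1)$, $$\operatorname{LogSumExp}(a_1,\dots,a_n)-\rho\ \le\ \inf_{\alpha\in\mathbb{R}}\left\{\alpha-1+\frac1\rho\sum_{i=1}^n\log\left(1+\rho e^{a_i-\alpha}\right)\right\}\ \le\ \operatorname{LogSumExp}(a_1,\dots,a_n).$$
   Context: $\operatorname{LogSumExp}(a_1,\dots,a_n):=\log\left(\sum_{i=1}^n e^{a_i}\right)$, where $\log$ is the natural logarithm and $n\ge1$. *)

(* Defs.v *)
From mathcomp Require Import all_boot all_order all_algebra.
From mathcomp Require Import all_classical all_reals all_analysis.

Set Implicit Arguments.
Unset Strict Implicit.
Unset Printing Implicit Defensive.

Import Order.TTheory GRing.Theory Num.Theory.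
Local Open Scope ring_scope.

(* Meaningful for n >= 1 only: the empty sum gives ln 0, a default value. *)
Definition LogSumExp (R : realType) (n : nat) (a : 'I_n -> R) : R :=
  ln (\sum_(i < n) expR (a i)).

(* Main.v *)
(* Since [\sum_i ln (1 + x_i) >= ln (1 + \sum_i x_i)] for [x_i >= 0], the lower
   bound reduces, with [t = LogSumExp a - alpha], to
   [expR (rho * (t + 1 - rho)) <= 1 + rho * expR t].  The exponent is the convex
   combination of [t] and [rho] with weights [rho] and [1 - rho], so convexity of
   [expR] concludes, as [(1 - rho) * expR rho <= 1].  The upper bound is the
   value at [alpha = LogSumExp a], estimated with [ln (1 + x) <= x]. *)
Require Import Defs.
From mathcomp Require Import all_boot all_order all_algebra.
From mathcomp Require Import all_classical all_reals all_analysis.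
From mathcomp Require Import ring lra.

Import Order.TTheory GRing.Theory Num.Theory.
Local Open Scope classical_set_scope.
Local Open Scope ring_scope.

(** By induction: [(1 + x i) * (1 + S)] exceeds [1 + x i + S] by the cross term [x i * S], which is
    nonnegative. *)
Lemma ln1D_sum_le (R : realType) (I : Type) (s : seq I) (x : I -> R) :
  (forall i, 0 <= x i) ->
  ln (1 + \sum_(i <- s) x i) <= \sum_(i <- s) ln (1 + x i).
Proof.
move=> x0; elim: s => [|i s IH].
  by rewrite !big_nil addr0 ln1.
rewrite !big_cons; have xi := x0 i.
have S0 : 0 <= \sum_(j <- s) x j by apply: sumr_ge0.
set S := \sum_(j <- s) x j in S0 IH *.
have p1 : 0 < 1 + x i by lra.
have p2 : 0 < 1 + S by lra.
apply: le_trans (lerD (lexx (ln (1 + x i))) IH).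
rewrite -lnM ?posrE// ler_ln ?posrE ?mulr_gt0//; last lra.
have := mulr_ge0 xi S0; lra.
Qed.

(** The tangent line at [c]: the form in which convexity of [expR] is used below. *)
Lemma expR_tangent_le (R : realType) (c t : R) :
  expR c * (1 + (t - c)) <= expR t.
Proof.
have -> : expR t = expR c * expR (t - c).
  by rewrite -expRD; congr expR; ring.
by rewrite ler_pM2l ?expR_gt0// expR_ge1Dx.
Qed.

Lemma expR_le_1D (R : realType) (rho t : R) : 0 <= rho <= 1 ->
  expR (rho * (t + 1 - rho)) <= 1 + rho * expR t.
Proof.
move=> /andP[rho0 rho1]; set c := rho * (t + 1 - rho).
have rho0' : 0 <= 1 - rho by rewrite subr_ge0.
have H1 := ler_wpM2l rho0 (expR_tangent_le R c t).
have H2 := ler_wpM2l rho0' (expR_tangent_le R c rho).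
(* Multiply [1 - rho <= expR (- rho)] by [expR rho]. *)
have H3 : (1 - rho) * expR rho <= 1.
  have := ler_wpM2l (expR_ge0 rho) (expR_ge1Dx (- rho)).
  by rewrite expRxMexpNx_1 mulrC.
(* The first-order terms cancel, since [c] is the weighted mean of [t] and [rho]. *)
have E : expR c = rho * (expR c * (1 + (t - c)))
    + (1 - rho) * (expR c * (1 + (rho - c))) by rewrite /c; ring.
rewrite E; lra.
Qed.

Theorem corollary2p5 (R : realType) (n : nat) (hn : (1 <= n)%N)
    (a : 'I_n -> R) (rho : R) (hrho0 : 0 < rho) (hrho1 : rho < 1) :
  let I := ereal_inf
    [set (alpha - 1 + rho^-1 * \sum_(i < n) ln (1 + rho * expR (a i - alpha)))%:E
      | alpha in [set: R]] in
  ((LogSumExp a - rho)%:E <= I)%E /\ (I <= (LogSumExp a)%:E)%E.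
Proof.
move=> I.
(* This is where [1 <= n] enters; positivity is what lets [expR] undo [ln] in [LogSumExp a]. *)
have S0 : 0 < \sum_(i < n) expR (a i).
  case: n hn a @I => // n _ a _; rewrite big_ord_recl.
  by apply: ltr_pwDl; [exact: expR_gt0|apply: sumr_ge0 => i _; exact: expR_ge0].
have sumE alpha : \sum_(i < n) rho * expR (a i - alpha)
    = rho * expR (LogSumExp a - alpha).
  rewrite -mulr_sumr expRD lnK ?posrE// mulr_suml.
  by congr (_ * _); apply: eq_bigr => i _; rewrite expRD.
split.
  apply: le_ereal_inf_tmp => _ [alpha _ <-]; rewrite lee_fin.
  have := ln1D_sum_le R _ (index_enum 'I_n)
    (fun i => rho * expR (a i - alpha))
    (fun i => mulr_ge0 (ltW hrho0) (expR_ge0 _)).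
  rewrite sumE; set t := LogSumExp a - alpha => le_sum.
  have le_ln : rho * (t + 1 - rho) <= ln (1 + rho * expR t).
    rewrite -[leLHS]expRK ler_ln ?posrE ?expR_gt0 ?expR_le_1D ?ltW//.
    by rewrite addr_gt0 ?mulr_gt0 ?expR_gt0.
  have := le_trans le_ln le_sum.
  (* Dividing by [rho] leaves [t + 1 - rho] on the left; adding [alpha - 1] to both sides gives the
     bound. *)
  by rewrite mulrC -ler_pdivlMr// mulrC /t; lra.
apply: le_trans (ereal_inf_lbound _) _; first by exists (LogSumExp a).
rewrite lee_fin.
(* For this [alpha] the terms [rho * expR (a i - alpha)] sum to exactly [rho]. *)
have le_sum : \sum_(i < n) ln (1 + rho * expR (a i - LogSumExp a)) <= rho.
  have := sumE (LogSumExp a); rewrite subrr expR0 mulr1 => rhoE.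
  rewrite -[leRHS]rhoE; apply: ler_sum => i _; apply: le_ln1Dx.
  by apply: (@lt_le_trans _ _ 0); rewrite ?oppr_lt0 ?ltW ?mulr_gt0 ?expR_gt0.
have : rho^-1 * \sum_(i < n) ln (1 + rho * expR (a i - LogSumExp a)) <= 1.
  by rewrite mulrC ler_pdivrMr// mul1r.
lra.
Qed.
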